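(* The $s$--$t$ path extension complexity of the perfect matching polytope of the complete bipartite graph $K_{n,n}$ satisfies $$\mathrm{xc}_{s\text{--}t\text{ path}}\bigl(P_{\mathrm{perfect\ matching}}(K_{n,n})\bigr)=\Theta^*(2^n).$$
   Context: $\Theta^*(\cdot)$ is $\Theta(\cdot)$ with polynomial factors ignored: $f(n)=\Theta^*(2^n)$ means that there is a polynomial $p$, positive on positive integers, with $2^n/p(n)\leqslant f(n)\leqslant p(n)2^n$ for all sufficiently large $n$. Perfect matching polytope: a perfect matching of an undirected graph $G=(V(G),E(G))$ is a set of edges $M\subseteq E(G)$ such that every vertex of $G$ is incident to exactly one edge of $M$. $P_{\mathrm{perfect\ matching}}(G)=\operatorname{conv}\{\chi^M\in\mathbb{R}^{E(G)} : M \text{ perfect matching of } G\}$, where $\chi^M$ is the incidence vector of $M$. Path extensions: let $N=(V,A)$ be a finite acyclic directed graph (parallel arcs allowed) with source $s\in V$ and sink $t\in V\setminus\{s\}$. Its $s$--$t$ path polytope is $Q=\operatorname{conv}\{\chi^\sigma\in\mathbb{R}^A:\sigma \text{ a directed } s\text{--}t \text{ path in } N\}$, where $\chi^\sigma$ is the characteristic vector of the arc set of $\sigma$. $Q$ is an $s$--$t$ path extension of a polytope $P\subseteq\mathbb{R}^d$ if there is a linear map $\pi:\mathbb{R}^A\to\mathbb{R}^d$ with $\pi(Q)=P$. The $s$--$t$ path extension complexity $\mathrm{xc}_{s\text{--}t\text{ path}}(P)$ is the minimum number of arcs of a network whose $s$--$t$ path polytope is an extension of $P$. *)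

(* Defs.v *)
From HB Require Import structures.
From mathcomp Require Import all_boot all_order all_algebra.
From mathcomp Require Import all_classical all_reals all_analysis.
Set Implicit Arguments.
Unset Strict Implicit.
Unset Printing Implicit Defensive.
Import Order.TTheory GRing.Theory Num.Theory.
Import numFieldNormedType.Exports.
Local Open Scope classical_set_scope.
Local Open Scope ring_scope.

(* [R^o] rather than [R], so that [{ffun I -> R^o}] is an R-module. *)
Notation rvec R I := {ffun I -> (R : realType)^o}.

Definition conv_hull (R : realType) (V : lmodType R) (X : set V) : set V :=
  smallest (@convex_set R V) X.

Definition incidence (R : realType) (I : finType) (S : {set I}) : rvec R I :=
  [ffun i => (i \in S)%:R].

Record sgraph := SGraph {
  vertex : finType;
  adj : rel vertex;
  adj_sym : symmetric adj;
  adj_irr : irreflexive adj }.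

Definition is_edge (G : sgraph) (e : {set vertex G}) : bool :=
  [exists x, exists y, adj x y && (e == [set x; y]%SET)].

Definition edge (G : sgraph) : finType := {e : {set vertex G} | is_edge e}.

Definition perfect_matching (G : sgraph) (M : {set edge G}) : Prop :=
  forall v : vertex G, #|[set e in M | v \in val e]%SET| = 1%N.

Definition perfect_matching_polytope (R : realType) (G : sgraph) :
    set (rvec R (edge G)) :=
  conv_hull [set incidence R M | M in @perfect_matching G].
Arguments perfect_matching_polytope R G : clear implicits.

Definition Knn_adj (n : nat) (x y : 'I_n + 'I_n) : bool :=
  match x, y with
  | inl _, inr _ | inr _, inl _ => true
  | _, _ => false
  end.

Fact Knn_adj_sym n : symmetric (@Knn_adj n).
Proof. by move=> [i|i] [j|j]. Qed.

Fact Knn_adj_irr n : irreflexive (@Knn_adj n).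
Proof. by move=> [i|i]. Qed.

Definition Knn (n : nat) : sgraph := SGraph (@Knn_adj_sym n) (@Knn_adj_irr n).

Section Walks.
Variables (V A : eqType) (tl hd : A -> V).

Fixpoint diwalk (x : V) (p : seq A) (y : V) : bool :=
  if p is a :: p' then (tl a == x) && diwalk (hd a) p' y else x == y.

Definition dipath (x : V) (p : seq A) (y : V) : bool :=
  diwalk x p y && uniq (x :: map hd p).

Definition acyclic : Prop := forall x p, diwalk x p x -> p = [::].

End Walks.

Record network := Network {
  nodes : finType;
  arcs : finType;
  arc_tail : arcs -> nodes;
  arc_head : arcs -> nodes;
  source : nodes;
  sink : nodes;
  sink_neq_source : sink != source;
  network_acyclic : acyclic arc_tail arc_head }.

Definition st_path (N : network) (p : seq (arcs N)) : Prop :=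
  dipath (@arc_tail N) (@arc_head N) (source N) p (sink N).

Definition st_path_polytope (R : realType) (N : network) :
    set (rvec R (arcs N)) :=
  conv_hull [set incidence R [set a in p]%SET | p in @st_path N].
Arguments st_path_polytope R N : clear implicits.

Definition st_path_extension (R : realType) (I : finType)
    (P : set (rvec R I)) (N : network) : Prop :=
  exists pi : {linear rvec R (arcs N) -> rvec R I},
    pi @` st_path_polytope R N = P.

Definition has_st_path_extension (R : realType) (I : finType)
    (P : set (rvec R I)) (k : nat) : Prop :=
  exists2 N : network, st_path_extension P N & #|arcs N| = k.

(* The default value 0 is taken only if [P] has no s-t path extension; it is
   never the number of arcs of an extension of a nonempty [P], since such a
   network has an s-t path and its source and sink differ. *)
Definition st_path_xc (R : realType) (I : finType) (P : set (rvec R I)) : nat :=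
  if pselect (exists k, `[< has_st_path_extension P k >]) is left exk
  then ex_minn exk else 0%N.

Definition Theta_star (R : realType) (f g : nat -> R) : Prop :=
  exists2 p : {poly R}, (forall n : nat, (0 < n)%N -> 0 < p.[n%:R]) &
    \forall n \near \oo, g n / p.[n%:R] <= f n <= p.[n%:R] * g n.

(* Main.v *)
(** Upper bound: let the nodes be the subsets of [n] and let the arc from [S] to
    [S + j] be mapped to the edge {|S|, j}; the paths from the empty set to [n]
    are the permutations.

    Lower bound: given an extension, shift the image of each arc by the potential
    [h v i j], the infimum of the (i, j)-coordinates of the [s]-[v] walks. Images
    of paths are unchanged and arcs become nonnegative, so along a path mapped to
    the matching of [m] all coordinates (i, j) with [j <> m i] vanish. The i-th row
    sum [r v i] and the j-th column sum [c v j] of an [s]-[v] walk depend only on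
    [v], and they grow from 0 to 1 along a path, with [r v i = c v (m i)]. Fix [k]
    and let [a = (u, v)] be an arc of the path of [m] at which the number of rows
    with [r >= 1] goes from below [k] to at least [k]. The rows that reach 1 at [a]
    have their image under [m] determined by [a], and [m] maps the rows complete
    before [a], resp. incomplete after it, to a set depending only on [a]. Hence at
    most [k! (n - k)!] permutations use [a], there are at least ['C(n, k)] arcs, and
    summing over [k] gives [2 ^ n <= (n + 1) * #arcs]. *)
From HB Require Import structures.
Require Import Defs.
From mathcomp Require Import all_boot all_order all_algebra all_fingroup.
From mathcomp Require Import all_classical all_reals all_analysis.
From mathcomp Require Import lra.
Set Implicit Arguments.
Unset Strict Implicit.
Unset Printing Implicit Defensive.
Import Order.TTheory GRing.Theory Num.Theory.
Local Open Scope ring_scope.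

(** * Counting permutations that stabilize two sets *)

(** The restrictions of [s] to [A] and [B] are permutations of these sets, and they determine [s],
    which is the identity elsewhere. *)
Lemma card_stab_perm (T : finType) (A B : {set T}) (S : {set {perm T}}) :
  (forall s x, s \in S -> x \in A -> s x \in A) ->
  (forall s x, s \in S -> x \in B -> s x \in B) ->
  (forall s x, s \in S -> x \notin A -> x \notin B -> s x = x) ->
  (#|S| <= #|A| `! * #|B| `!)%N.
Proof.
move=> SA SB Sfix.
have stab (D : {set T}) (s : {perm T}) : (forall x, x \in D -> s x \in D) ->
    s \in ('N(D | 'P))%g.
  by move=> sD; rewrite !inE; apply/fintype.subsetP => x; rewrite !inE; apply: sD.
pose f s := (restr_perm A s, restr_perm B s).
have finj : {in S &, injective f}.
  move=> s s' Ss Ss' [eA eB]; apply/permP => x.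
  have [xA|xA] := boolP (x \in A).
    rewrite -(restr_permE _ xA) ?eA ?restr_permE //; apply: stab => y; exact: SA.
  have [xB|xB] := boolP (x \in B).
    rewrite -(restr_permE _ xB) ?eB ?restr_permE //; apply: stab => y; exact: SB.
  by rewrite !Sfix.
rewrite -(card_in_imset finj) -!card_perm.
rewrite -[#|perm_on A|]cardsE -[#|perm_on B|]cardsE -cardsX.
apply/subset_leq_card/fintype.subsetP => _ /imsetP[s _ ->].
by rewrite finset.in_setX; apply/andP; split; rewrite inE; apply: restr_perm_on.
Qed.

(** * Walks in acyclic directed graphs *)

Section Walks.
Variables (V A : eqType) (tl hd : A -> V).

Lemma diwalk_cat x p q z :
  diwalk tl hd x (p ++ q) z ->
  exists2 y, diwalk tl hd x p y & diwalk tl hd y q z.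
Proof.
elim: p x => [|a p IH] x /=; first by exists x.
by case/andP=> tax /IH [y wp wq]; exists y => //; rewrite tax.
Qed.

Lemma cat_diwalk x y z p q :
  diwalk tl hd x p y -> diwalk tl hd y q z -> diwalk tl hd x (p ++ q) z.
Proof.
elim: p x => [|a p IH] x /=; first by move/eqP->.
by case/andP=> -> /IH; apply.
Qed.

Lemma diwalk_rcons x a p :
  diwalk tl hd x p (tl a) -> diwalk tl hd x (rcons p a) (hd a).
Proof. by move=> wp; rewrite -cats1; apply: cat_diwalk wp _; rewrite /= !eqxx. Qed.

(** If the start [x] recurred as the head of an arc [b], the part of the walk up to [b] would be a
    nonempty closed walk. *)
Lemma diwalk_uniq x p y :
  acyclic tl hd -> diwalk tl hd x p y -> uniq (x :: map hd p).
Proof.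
move=> acy; elim: p x => [//|a p IH] x /= /andP[/eqP tax wp].
rewrite -/(uniq (hd a :: map hd p)) (IH _ wp) andbT.
apply/negP => xap.
have /mapP[b bp xb] := xap : x \in map hd (a :: p).
have [p1 [p2 E]] : exists p1 p2, a :: p = rcons p1 b ++ p2.
  by case/splitPr: bp => p1 p2; exists p1, p2; rewrite cat_rcons.
have: diwalk tl hd x (a :: p) y by rewrite /= tax eqxx.
rewrite E => /diwalk_cat[z wz _].
have zb : z = hd b.
  move: wz; rewrite -cats1 => /diwalk_cat[z' _] /=.
  by case/andP => _ /eqP.
move: wz; rewrite zb -xb => /acy E0.
by move: E0; case: (p1).
Qed.

Lemma dipathE x p y :
  acyclic tl hd -> dipath tl hd x p y = diwalk tl hd x p y.
Proof.
move=> acy; rewrite /dipath; apply: andb_idr; exact: diwalk_uniq.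
Qed.

Lemma diwalk_crossing (f : V -> nat) k x p y :
  diwalk tl hd x p y -> (f x < k)%N -> (k <= f y)%N ->
  exists p1 a p2, [/\ p = p1 ++ a :: p2, (f (tl a) < k)%N & (k <= f (hd a))%N].
Proof.
elim: p x => [|a p IH] x /=.
  by move/eqP-> => lt le; move: (leq_trans lt le); rewrite ltnn.
case/andP=> /eqP tax wp fx fy.
have [ka|ak] := leqP k (f (hd a)).
  by exists [::], a, p; rewrite tax.
have [p1 [b [p2 [-> ? ?]]]] := IH _ wp ak fy.
by exists (a :: p1), b, p2.
Qed.

End Walks.

(** * Lower bound on the number of arcs *)

Section LowerBound.
Variables (R : realType) (V A : finType) (tl hd : A -> V) (s t : V) (n : nat).
(** [w a i j] stands for the (i, j)-coordinate of the image of the arc [a]. The hypotheses on [W]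
    say that images of [s]-[t] walks are doubly stochastic and that every permutation matrix is such
    an image. *)
Variable w : A -> 'I_n -> 'I_n -> R.

Let walk := diwalk tl hd.
Let W (p : seq A) i j : R := \sum_(a <- p) w a i j.

Hypothesis acy : acyclic tl hd.
Hypothesis W_ge0 : forall p i j, walk s p t -> 0 <= W p i j.
Hypothesis W_row : forall p i, walk s p t -> \sum_j W p i j = 1.
Hypothesis W_col : forall p j, walk s p t -> \sum_i W p i j = 1.
Hypothesis W_perm : forall m : 'S_n,
  exists2 p, walk s p t & forall i j, W p i j = (m i == j)%:R.

Let W_cat p q i j : W (p ++ q) i j = W p i j + W q i j.
Proof. by rewrite /W big_cat. Qed.

Let reach v := exists p, walk s p v.
Let live v := exists q, walk v q t.
(** This infimum is meaningful when [reach v] makes the set nonempty and [live v] makes it bounded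
    below. *)
Let h v i j : R := inf [set W p i j | p in [set p | walk s p v]]%classic.

Let le_h v i j c :
  reach v -> (forall p, walk s p v -> c <= W p i j) -> c <= h v i j.
Proof.
move=> [p0 w0] le_c; apply: lb_le_inf; first by exists (W p0 i j), p0.
by move=> _ [p wp <-]; apply: le_c.
Qed.

Let h_le v p i j : live v -> walk s p v -> h v i j <= W p i j.
Proof.
move=> [q wq] wp; apply: ge_inf; last by exists p.
exists (- W q i j) => _ [p' wp' <-].
by rewrite -subr_ge0 opprK -W_cat; apply: W_ge0; apply: cat_diwalk wp' wq.
Qed.

Let oppW_le_h v q i j : reach v -> walk v q t -> - W q i j <= h v i j.
Proof.
move=> rv wq; apply: le_h => // p wp.
by rewrite -subr_ge0 opprK -W_cat; apply: W_ge0; apply: cat_diwalk wp wq.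
Qed.

(** Every [s]-[v] walk completed by [q] has nonnegative weight, so [h] lies between [- W q] and
    [W p]; these coincide when the total is 0. *)
Let W_eq0 v p q i j : walk s p v -> walk v q t -> W (p ++ q) i j = 0 ->
  W p i j = h v i j.
Proof.
move=> wp wq; rewrite W_cat => W0.
have := oppW_le_h i j (ex_intro _ p wp) wq.
have := h_le i j (ex_intro _ q wq) wp.
by move=> le1 le2; apply/eqP; rewrite eq_le le1 andbT; lra.
Qed.

(** An arbitrary [s]-[v] walk; by [rE] and [cE] below, the choice does not affect [r] and [c] at
    live reachable nodes. *)
Let pre v : seq A := xget [::] [set p | walk s p v]%classic.
Let pre_walk v : reach v -> walk s (pre v) v.
Proof. by move=> [p wp]; rewrite /pre; case: xgetP => // /(_ p). Qed.

Let r v i : R := \sum_j (W (pre v) i j - h v i j).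
Let c v j : R := \sum_i (W (pre v) i j - h v i j).

(* Completing two [s]-[v] walks by the same [v]-[t] walk shows that row and
   column sums of an [s]-[v] walk depend on [v] only. *)
Let rE v p i : live v -> walk s p v -> r v i = \sum_j (W p i j - h v i j).
Proof.
move=> [q wq] wp; have wpre := pre_walk (ex_intro _ p wp).
have := W_row i (cat_diwalk wp wq).
rewrite -(W_row i (cat_diwalk wpre wq)) /r !sumrB.
under eq_bigr do rewrite W_cat.
under [X in _ = X]eq_bigr do rewrite W_cat.
by rewrite !big_split /= => /addIr ->.
Qed.

Let cE v p j : live v -> walk s p v -> c v j = \sum_i (W p i j - h v i j).
Proof.
move=> [q wq] wp; have wpre := pre_walk (ex_intro _ p wp).
have := W_col j (cat_diwalk wp wq).
rewrite -(W_col j (cat_diwalk wpre wq)) /c !sumrB.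
under eq_bigr do rewrite W_cat.
under [X in _ = X]eq_bigr do rewrite W_cat.
by rewrite !big_split /= => /addIr ->.
Qed.

(** By [W_eq0] the shifted entries (i', j) with [m i' != j] vanish, so row [i] and column [m i] both
    sum to their common entry. *)
Let r_perm v p q (m : 'S_n) i : walk s p v -> walk v q t ->
  (forall i j, W (p ++ q) i j = (m i == j)%:R) -> r v i = c v (m i).
Proof.
move=> wp wq Wm; have lv : live v by exists q.
have W0 i' j : m i' != j -> W p i' j - h v i' j = 0.
  by move=> /negPf ne; apply/eqP; rewrite subr_eq0; apply/eqP;
     apply: (W_eq0 wp wq); rewrite Wm ne.
rewrite (rE i lv wp) (cE (m i) lv wp) (bigD1 (m i)) //= [RHS](bigD1 i) //=.
rewrite !big1 // => k kne; apply: W0; first by rewrite (inj_eq perm_inj).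
by rewrite eq_sym.
Qed.

Let d a i j : R := w a i j + h (tl a) i j - h (hd a) i j.

Let d_ge0 a i j : reach (tl a) -> live (hd a) -> 0 <= d a i j.
Proof.
move=> ra la; rewrite /d; suff: h (hd a) i j - w a i j <= h (tl a) i j by lra.
apply: le_h => // p wp.
have := h_le i j la (diwalk_rcons wp).
by rewrite -cats1 W_cat {2}/W big_seq1; lra.
Qed.

Let r_arc a i : reach (tl a) -> live (hd a) ->
  r (hd a) i = r (tl a) i + \sum_j d a i j.
Proof.
move=> [p wp] la.
have la' : live (tl a) by case: la => q wq; exists (a :: q); rewrite /walk/= eqxx.
rewrite (rE i la (diwalk_rcons wp)) (rE i la' wp) -big_split /=.
by apply: eq_bigr => j _; rewrite /d -cats1 W_cat {2}/W big_seq1; lra.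
Qed.

(** By [W_eq0] the walk attains the infimum [h] both before and after [a], so [w a] is exactly the
    difference of potentials. *)
Let d_perm a p q (m : 'S_n) i j : walk s (p ++ a :: q) t ->
  (forall i j, W (p ++ a :: q) i j = (m i == j)%:R) -> m i != j -> d a i j = 0.
Proof.
move=> /diwalk_cat[u wp wq] Wm /negPf ne.
have wq' := wq; case/andP: wq' => /eqP ua wq'; rewrite -ua in wp wq.
have := W_eq0 wp wq (i := i) (j := j); rewrite Wm ne => /(_ erefl).
have := W_eq0 (diwalk_rcons wp) wq' (i := i) (j := j).
rewrite cat_rcons Wm ne => /(_ erefl).
by rewrite -cats1 W_cat {2}/W big_seq1 /d; lra.
Qed.

Let r_s i : r s i = 0.
Proof.
have [q wq _] := W_perm 1%g.
have ws : walk s [::] s by rewrite /walk /=.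
rewrite (rE i (ex_intro _ q wq) ws); apply: big1 => j _.
have W0 : W [::] i j = 0 by rewrite /W big_nil.
apply/eqP; rewrite W0 sub0r oppr_eq0 eq_le -{1}W0 h_le //=; last by exists q.
by apply: le_h; [exists [::]|move=> p /acy ->; rewrite W0].
Qed.

(** The potential at [t] is 0, since some permutation avoids the entry (i, j). This needs a second
    column: for [n = 1] the potential would be 1 and [r t i] would be 0. *)
Let r_t i : (1 < n)%N -> r t i = 1.
Proof.
move=> n1; have wt : walk t [::] t by rewrite /walk /=.
have lt : live t by exists [::].
have [p wp _] := W_perm 1%g.
rewrite (rE i lt wp) sumrB W_row // big1 ?subr0 // => j _.
apply/eqP; rewrite eq_le le_h ?andbT; last 2 first.
- by exists p.
- by move=> p' wp'; apply: W_ge0.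
have [k kj] : exists k : 'I_n, k != j.
  have: (0 < #|[set~ j]|)%N by rewrite cardsC1 card_ord; case: (n) n1 => [|[]].
  by case/card_gt0P => k; rewrite !inE => kj; exists k.
have [p' wp' Wp'] := W_perm (tperm i k).
by apply: le_trans (h_le i j lt wp') _; rewrite Wp' tpermL (negPf kj).
Qed.

Let L v := [set i | 1 <= r v i]%SET.

Let through k a : {set 'S_n} := [set m : 'S_n | `[< exists p q,
   [/\ walk s (p ++ a :: q) t,
       forall i j, W (p ++ a :: q) i j = (m i == j)%:R &
       (#|L (tl a)| < k <= #|L (hd a)|)%N] >] ]%SET.

(* Quotients of permutations in [through k a] fix [L (hd a) :\: L (tl a)]
   pointwise, where the row sums of [d a] are positive, and stabilize [L (tl a)]
   and the complement of [L (hd a)]. *)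
Let card_through k a : (#|through k a| <= k`! * (n - k)`!)%N.
Proof.
have [->|[m0 m0T]] := set_0Vmem (through k a); first by rewrite cards0.
have m0T' := m0T; move: m0T'; rewrite inE => /asboolP[p0 [q0 [w0 W0 /andP[Lu Lv]]]].
have /diwalk_cat[u wp0 wq0] := w0.
have wq0' := wq0; case/andP: wq0' => /eqP ua wq0'; rewrite -ua in wp0 wq0.
have ra : reach (tl a) by exists p0.
have la : live (hd a) by exists q0.
have mT m i : m \in through k a ->
    [/\ r (tl a) i = c (tl a) (m i), r (hd a) i = c (hd a) (m i) &
        forall j, m i != j -> d a i j = 0].
  rewrite inE => /asboolP[p [q [wpq Wpq _]]].
  have /diwalk_cat[u' wp wq] := wpq.
  have wq' := wq; case/andP: wq' => /eqP ua' wq'; rewrite -ua' in wp wq.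
  split.
  - exact: (r_perm i wp wq Wpq).
  - by apply: (r_perm i (diwalk_rcons wp) wq' _); rewrite cat_rcons.
  - by move=> j; apply: d_perm wpq Wpq.
pose S := [set (m * m0^-1)%g | m in through k a]%SET.
have SP s' : s' \in S -> exists2 m, m \in through k a & forall i, m0 (s' i) = m i.
  by case/imsetP => m mt ->; exists m => // i; rewrite permM permKV.
(* Each equality goes through the column function: [r (s' i) = c (m0 (s' i)) = c (m i) = r i]. *)
have Sr s' i : s' \in S -> r (tl a) (s' i) = r (tl a) i /\ r (hd a) (s' i) = r (hd a) i.
  move=> /SP[m mt em].
  have [-> -> _] := mT _ (s' i) m0T; have [-> -> _] := mT _ i mt.
  by rewrite em.
rewrite -(card_imset (mem (through k a)) (mulIg m0^-1%g)) -/S.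
apply: leq_trans (card_stab_perm (A := L (tl a)) (B := ~: L (hd a)) _ _ _) _.
- by move=> s' i /(Sr _ i)[e _]; rewrite !inE e.
- by move=> s' i /(Sr _ i)[_ e]; rewrite !inE e.
- move=> s' i /SP[m mt em]; rewrite !inE negbK => ru rv.
  (* Row [i] is incomplete before [a] and complete after it. *)
  have rlt : 0 < \sum_j d a i j.
    by move: rv ru; rewrite (r_arc i ra la) -ltNge; lra.
  apply: (@perm_inj _ m0); rewrite em; apply/eqP/negP => /negP ne.
  (* If [m i] and [m0 i] differ, each column [j] is missed by one of them, so row [i] of [d a]
     vanishes entirely. *)
  move: rlt; rewrite big1 ?ltxx // => j _.
  have [_ _ dm] := mT _ i mt; have [_ _ dm0] := mT _ i m0T.
  have [mj|] := eqVneq (m i) j; last exact: dm.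
  by apply: dm0; rewrite eq_sym -mj.
- apply: leq_mul; apply: leq_fact; first exact: ltnW.
  by rewrite cardsCs finset.setCK card_ord leq_sub2l.
Qed.

(** No row is complete at [s] and all [n] are at [t], so for [0 < k <= n] the sets [through k a]
    cover all [n!] permutations. *)
Lemma bin_le_arcs k : (1 < n)%N -> (0 < k <= n)%N -> ('C(n, k) <= #|A|)%N.
Proof.
move=> n1 /andP[k0 kn].
have: (#|[set: 'S_n]%SET| <= \sum_a #|through k a|)%N.
  under eq_bigr do rewrite -sum1_card big_mkcond.
  rewrite exchange_big -sum1_card /= big_mkcond /=; apply: leq_sum => m _.
  rewrite inE.
  have [p wp Wp] := W_perm m.
  have := @diwalk_crossing _ _ _ _ (fun v => #|L v|) k _ _ _ wp.
  have -> : #|L s| = 0%N.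
    by apply: eq_card0 => i; rewrite inE r_s ler10.
  have -> : #|L t| = n.
    by rewrite -[RHS]card_ord; apply: eq_card => i; rewrite inE r_t // lexx.
  case=> // p1 [a [p2 [Ep ? ?]]]; rewrite Ep in wp Wp.
  rewrite (bigD1 a) //= ifT // inE; apply/asboolP; exists p1, p2; split=> //.
  exact/andP.
rewrite cardsT card_Sn => le_n.
have: (n`! <= \sum_(a : A) k`! * (n - k)`!)%N.
  by apply: leq_trans le_n _; apply: leq_sum => a _; apply: card_through.
rewrite sum_nat_const -(bin_fact kn) leq_pmul2r // muln_gt0.
by rewrite !fact_gt0.
Qed.

End LowerBound.

(** * Convex hulls under linear maps *)

Section ConvexHull.
Variable R : realType.

(** Replaces interval-typed coefficients by plain reals with bounds. *)
Lemma convex_setP (V : lmodType R) (C : set V) :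
  convex_set C <-> forall x y (l : R), 0 <= l <= 1 -> C x -> C y ->
    C (l *: x + (1 - l) *: y).
Proof.
split=> [Cc x y l l01 Cx Cy|Cc x y l /set_mem Cx /set_mem Cy].
  have [l0 l1] := andP l01.
  have -> : l = (Itv01 l0 l1)%:num by [].
  by apply: set_mem; apply: Cc; apply/mem_set.
by apply/mem_set; apply: Cc => //; apply/andP; split.
Qed.

Lemma convex_conv_hull (V : lmodType R) (X : set V) : convex_set (conv_hull X).
Proof.
apply/convex_setP => x y l l01 hx hy C [Cc XC].
by apply: (convex_setP C).1 => //; [apply: hx|apply: hy].
Qed.

(** Both inclusions use minimality of the hull: linear preimages and linear images of convex sets
    are convex. *)
Lemma image_conv_hull (V W : lmodType R) (f : {linear V -> W}) (X : set V) :
  (f @` conv_hull X = conv_hull (f @` X))%classic.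
Proof.
apply/seteqP; split.
  move=> _ [x hx <-].
  apply: (smallest_sub (X := (f @^-1` conv_hull (f @` X))%classic) _ _ hx).
    apply/convex_setP => y z l l01 hy hz /=.
    rewrite linearD !linearZ /=.
    exact: (convex_setP _).1 (@convex_conv_hull _ _) _ _ _ _ _ _.
  by move=> y Xy; apply: sub_gen_smallest; exists y.
apply: smallest_sub; last by move=> _ [x Xx <-]; exists x => //; apply: sub_gen_smallest.
apply/convex_setP => _ _ l l01 [x hx <-] [y hy <-].
exists (l *: x + (1 - l) *: y); last by rewrite linearD !linearZ.
exact: (convex_setP _).1 (@convex_conv_hull _ _) _ _ _ _ _ _.
Qed.

End ConvexHull.

(** * Linear maps on incidence vectors *)

Section FiberSum.
Variables (R : realType) (I J : finType) (f : I -> J).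

Definition fiber_sum (z : rvec R I) : rvec R J :=
  [ffun j => \sum_(i | f i == j) z i].

Fact fiber_sum_is_linear : linear fiber_sum.
Proof.
move=> a x y; apply/ffunP => j; rewrite !ffunE scaler_sumr -big_split /=.
by apply: eq_bigr => i _; rewrite !ffunE.
Qed.

HB.instance Definition _ :=
  GRing.isLinear.Build R (rvec R I) (rvec R J) _ fiber_sum fiber_sum_is_linear.

End FiberSum.

Lemma uniq_map_inj (T1 T2 : eqType) (f : T1 -> T2) (s : seq T1) :
  uniq (map f s) -> {in s &, injective f}.
Proof.
move=> us x y xs ys fxy; apply/eqP/negPn/negP => ne.
move: us; rewrite (perm_uniq (perm_map f (perm_to_rem xs))) /= => /andP[+ _].
rewrite (perm_mem (perm_to_rem xs)) inE eq_sym (negPf ne) /= in ys.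
by rewrite fxy map_f.
Qed.

(** As [f] is injective on [s], each fiber meets [s] at most once and the coordinates stay 0 or
    1. *)
Lemma fiber_sum_incidence (R : realType) (I J : finType) (f : I -> J)
    (s : seq I) : uniq (map f s) ->
  fiber_sum f (incidence R [set i in s]%SET) =
  incidence R [set j in map f s]%SET.
Proof.
move=> us; apply/ffunP => j; rewrite !ffunE inE.
have [/mapP[i si ->]|js] := boolP (j \in map f s).
  rewrite (bigD1 i) //= ffunE inE si big1 ?addr0 // => k /andP[/eqP fk ki].
  rewrite ffunE inE; have [sk|//] := boolP (k \in s).
  by case/eqP: ki; apply: (uniq_map_inj us).
rewrite big1 // => i /eqP fi; rewrite ffunE inE.
by case: (boolP (i \in s)) => // si; rewrite -fi map_f in js.
Qed.

(** Makes the image of a path additive over its arcs, as the lower bound requires. *)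
Lemma linear_incidence (R : realType) (I J : finType)
    (f : {linear rvec R I -> rvec R J}) (s : seq I) j : uniq s ->
  f (incidence R [set i in s]%SET) j =
  \sum_(i <- s) f (incidence R [set i]%SET) j.
Proof.
move=> us; rewrite -sum_ffunE -linear_sum; congr (f _ j).
apply/ffunP => k; rewrite sum_ffunE ffunE inE.
under eq_bigr do rewrite ffunE inE.
have [ks|ks] := boolP (k \in s).
  by rewrite (bigD1_seq k) //= eqxx big1 ?addr0 // => i; rewrite eq_sym => /negPf->.
rewrite big_seq big1 // => i si.
by case: eqP => // ki; rewrite ki si in ks.
Qed.

(** * Perfect matchings of the complete bipartite graph *)

Section Knn.
Variable n : nat.

Definition Knn_edge_set (ij : 'I_n * 'I_n) : {set vertex (Knn n)} :=
  [set inl ij.1; inr ij.2]%SET.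

Fact Knn_edge_setP ij : is_edge (Knn_edge_set ij).
Proof.
by apply/existsP; exists (inl ij.1); apply/existsP; exists (inr ij.2); apply/eqP.
Qed.

Definition Knn_edge ij : edge (Knn n) :=
  exist (fun e => is_edge e) _ (Knn_edge_setP ij).

Lemma inl_Knn_edge i ij : (inl i \in val (Knn_edge ij)) = (ij.1 == i).
Proof. by rewrite !inE orbF eq_sym. Qed.

Lemma inr_Knn_edge j ij : (inr j \in val (Knn_edge ij)) = (ij.2 == j).
Proof. by rewrite !inE /= eq_sym. Qed.

Lemma Knn_edge_inj : injective Knn_edge.
Proof.
move=> [i j] [i' j'] E.
have := inl_Knn_edge i (i, j); have := inr_Knn_edge j (i, j).
by rewrite E inl_Knn_edge inr_Knn_edge /= !eqxx => /eqP -> /eqP ->.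
Qed.

Lemma Knn_edge_surj e : exists ij, e = Knn_edge ij.
Proof.
case: e => e ee; have := ee.
move=> /existsP[[i|i] /existsP[[j|j] /andP[//= _ /eqP E]]].
  by exists (i, j); apply/val_inj; rewrite /= E.
by exists (j, i); apply/val_inj; rewrite /= E finset.setUC.
Qed.

Definition Knn_matching (m : 'S_n) : {set edge (Knn n)} :=
  [set Knn_edge (i, m i) | i : 'I_n]%SET.

Lemma mem_Knn_matching m ij : (Knn_edge ij \in Knn_matching m) = (m ij.1 == ij.2).
Proof.
apply/imsetP/eqP => [[i _ /Knn_edge_inj ->] //|E].
by exists ij.1 => //; rewrite E -surjective_pairing.
Qed.

Lemma perfect_Knn_matching m : perfect_matching (Knn_matching m).
Proof.
move=> v; case: v => k.
  rewrite (_ : [set _ in _ | _]%SET = [set Knn_edge (k, m k)]%SET) ?cards1 //.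
  apply/setP => e; have [ij ->] := Knn_edge_surj e.
  rewrite finset.in_set mem_Knn_matching inl_Knn_edge finset.in_set1 (inj_eq Knn_edge_inj).
  case: ij => i j; rewrite xpair_eqE /= andbC.
  by case: (eqVneq i k) => //= ->; rewrite eq_sym.
pose i := (m^-1)%g k.
rewrite (_ : [set _ in _ | _]%SET = [set Knn_edge (i, k)]%SET) ?cards1 //.
apply/setP => e; have [ij ->] := Knn_edge_surj e.
rewrite finset.in_set mem_Knn_matching inr_Knn_edge finset.in_set1 (inj_eq Knn_edge_inj).
case: ij => i' j; rewrite xpair_eqE /= andbC [in RHS]andbC.
by case: (eqVneq j k) => //= ->; rewrite -(inj_eq (@perm_inj _ m) i') permKV.
Qed.

(** The edge at each left vertex defines a map to the right vertices; it is injective because each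
    right vertex has only one edge. *)
Lemma perfect_matching_Knn (M : {set edge (Knn n)}) :
  perfect_matching M -> exists m, M = Knn_matching m.
Proof.
move=> Mp.
have uniqe v e e' : e \in M -> v \in val e -> e' \in M -> v \in val e' -> e = e'.
  move=> eM ve eM' ve'; have /eqP/cards1P[e0 E] := Mp v.
  have: e \in [set e0]%SET by rewrite -E inE eM.
  have: e' \in [set e0]%SET by rewrite -E inE eM'.
  by move=> /set1P -> /set1P ->.
have ex i : exists j, Knn_edge (i, j) \in M.
  have /eqP/cards1P[e0 E] := Mp (inl i).
  have: e0 \in [set e0]%SET by rewrite inE.
  rewrite -E inE; have [[i' j] ->] := Knn_edge_surj e0.
  by rewrite inl_Knn_edge /= => /andP[eM /eqP <-]; exists j.
pose f i := xchoose (ex i).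
have fM i : Knn_edge (i, f i) \in M by exact: (xchooseP (ex i)).
have finj : injective f.
  move=> i i' E.
  have := uniqe (inr (f i)) _ _ (fM i) _ (fM i').
  rewrite !inr_Knn_edge /= E eqxx => /(_ isT isT) /Knn_edge_inj.
  by case.
exists (perm finj); apply/setP => e; have [[i j] ->] := Knn_edge_surj e.
rewrite mem_Knn_matching permE /=; apply/idP/eqP => [eM|<-//].
have := uniqe (inl i) _ _ eM _ (fM i).
by rewrite !inl_Knn_edge /= eqxx => /(_ isT isT) /Knn_edge_inj [].
Qed.

Variable R : realType.

(** The easy half of Birkhoff's theorem: doubly stochastic matrices form a convex set containing the
    permutation matrices. *)
Lemma perfect_matching_polytopeP (x : rvec R (edge (Knn n))) :
  perfect_matching_polytope R (Knn n) x ->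
  [/\ forall e, 0 <= x e,
      forall i, \sum_j x (Knn_edge (i, j)) = 1 &
      forall j, \sum_i x (Knn_edge (i, j)) = 1].
Proof.
apply: (smallest_sub (X := [set x : rvec R (edge (Knn n)) |
  [/\ forall e, 0 <= x e,
      forall i, \sum_j x (Knn_edge (i, j)) = 1 &
      forall j, \sum_i x (Knn_edge (i, j)) = 1]]%classic)).
  apply/convex_setP => y z l /andP[l0 l1] [y0 yr yc] [z0 zr zc]; split.
  - by move=> e; rewrite !ffunE addr_ge0 // mulr_ge0 // subr_ge0.
  - move=> i; under eq_bigr do rewrite !ffunE.
    by rewrite big_split /= -!mulr_sumr yr zr !mulr1 subrKC.
  - move=> j; under eq_bigr do rewrite !ffunE.
    by rewrite big_split /= -!mulr_sumr yc zc !mulr1 subrKC.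
move=> _ [M Mp <-]; have [m ->] := perfect_matching_Knn Mp; split.
- by move=> e; rewrite ffunE ler0n.
- move=> i; rewrite (bigD1 (m i)) //= ffunE mem_Knn_matching eqxx.
  rewrite big1 ?addr0 // => j; rewrite eq_sym => /negPf ne.
  by rewrite ffunE mem_Knn_matching ne.
- move=> j; rewrite (bigD1 ((m^-1)%g j)) //= ffunE mem_Knn_matching permKV eqxx.
  rewrite big1 ?addr0 // => i ne.
  rewrite ffunE mem_Knn_matching /= -{1}[j](permKV m) (inj_eq perm_inj).
  by rewrite (negPf ne).
Qed.

(* The functional [x |-> \sum_i x (i, m i)] is at most [n] on the polytope and
   equals [n] only at the vertex of [m], so that vertex must be the image of a
   generator. *)
Lemma vertex_preimage (V : lmodType R) (f : {linear V -> rvec R (edge (Knn n))})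
    (X : set V) (m : 'S_n) :
  (f @` conv_hull X = perfect_matching_polytope R (Knn n))%classic ->
  exists2 x, X x & f x = incidence R (Knn_matching m).
Proof.
move=> fX; pose F (x : rvec R (edge (Knn n))) := \sum_i x (Knn_edge (i, m i)).
apply: contrapT => nex.
have FM : F (incidence R (Knn_matching m)) = n%:R.
  rewrite /F; under eq_bigr do rewrite ffunE mem_Knn_matching eqxx.
  by rewrite sumr_const card_ord.
have: (f @` conv_hull X)%classic (incidence R (Knn_matching m)).
  rewrite fX; apply: sub_gen_smallest; exists (Knn_matching m) => //.
  exact: perfect_Knn_matching.
case=> z hz fz.
suff: F (f z) < n%:R by rewrite fz FM ltxx.
apply: (smallest_sub (X := [set z | F (f z) < n%:R]%classic) _ _ hz).
  apply/convex_setP => x y l /andP[l0 l1] /= Fx Fy.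
  have -> : F (f (l *: x + (1 - l) *: y)) = l * F (f x) + (1 - l) * F (f y).
    rewrite linearD !linearZ /F !mulr_sumr -big_split /=.
    by apply: eq_bigr => i _; rewrite !ffunE.
  (* The first term yields a strict inequality only for [l > 0], hence the separate case. *)
  have [->|l_neq0] := eqVneq l 0; first by rewrite mul0r add0r subr0 mul1r.
  have h1 : 0 < l * (n%:R - F (f x)).
    by rewrite mulr_gt0 ?subr_gt0 // lt_def l_neq0.
  have h2 : 0 <= (1 - l) * (n%:R - F (f y)).
    by rewrite mulr_ge0 ?subr_ge0 // ltW.
  by move: h1 h2; rewrite !mulrBr !mulrBl !mul1r; lra.
move=> x Xx /=; rewrite ltNge; apply/negP => Fn; apply: nex; exists x => //.
have /perfect_matching_polytopeP[x0 xr _] :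
    perfect_matching_polytope R (Knn n) (f x).
  by rewrite -fX; exists x => //; apply: sub_gen_smallest.
have le1 i : f x (Knn_edge (i, m i)) <= 1.
  by rewrite -(xr i) (bigD1 (m i)) //= lerDl sumr_ge0.
(* A sum of [n] entries, each at most 1, reaches [n] only if all are 1. *)
have eq1 i : f x (Knn_edge (i, m i)) = 1.
  apply/eqP; rewrite eq_le le1 /= leNgt; apply/negP => lt1.
  move: Fn; apply/negP; rewrite -ltNge /F -[X in _ < X%:R]card_ord -sum1_card.
  rewrite natr_sum (bigD1 i) //= [ltRHS](bigD1 i) //=.
  by apply: ltr_leD => //; apply: ler_sum.
apply/ffunP => e; have [[i j] ->] := Knn_edge_surj e.
rewrite ffunE mem_Knn_matching /=; have [<-|ne] := eqVneq; first exact: eq1.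
(* The other entries of row [i] are nonnegative with sum 0. *)
have := xr i; rewrite (bigD1 (m i)) //= eq1.
move=> /eqP; rewrite -subr_eq0 addrAC subrr add0r psumr_eq0 //.
by move=> /allP/(_ j (mem_index_enum _)); rewrite eq_sym ne => /eqP.
Qed.

(** The weight of an arc is the image of its unit vector; [vertex_preimage] supplies a path for each
    permutation. *)
Lemma bin_le_extension_arcs (N : network) k :
  st_path_extension (perfect_matching_polytope R (Knn n)) N ->
  (1 < n)%N -> (0 < k <= n)%N -> ('C(n, k) <= #|arcs N|)%N.
Proof.
move=> [f fP] n1 kn.
have acy := @network_acyclic N.
pose w (a : arcs N) i j : R := f (incidence R [set a]%SET) (Knn_edge (i, j)).
have wE p i j : st_path p ->
    f (incidence R [set a in p]%SET) (Knn_edge (i, j)) = \sum_(a <- p) w a i j.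
  rewrite /st_path => /andP[_ /andP[_ /map_uniq up]]; exact: linear_incidence.
have inP p : st_path p ->
    perfect_matching_polytope R (Knn n) (f (incidence R [set a in p]%SET)).
  move=> sp; rewrite -fP; exists (incidence R [set a in p]%SET) => //.
  by apply: sub_gen_smallest; exists p.
have st p : diwalk (@arc_tail N) (@arc_head N) (source N) p (sink N) <-> st_path p.
  by rewrite /st_path dipathE.
apply: (@bin_le_arcs R _ _ _ _ (source N) (sink N) n w acy) => //.
- move=> p i j /st sp; rewrite -wE //.
  by have [] := perfect_matching_polytopeP (inP p sp).
- move=> p i /st sp; under eq_bigr do rewrite -wE //.
  by have [] := perfect_matching_polytopeP (inP p sp).
- move=> p i /st sp; under eq_bigr do rewrite -wE //.
  by have [] := perfect_matching_polytopeP (inP p sp).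
move=> m; have [_ [p sp <-] fp] := vertex_preimage m fP.
exists p; first exact/st.
by move=> i j; rewrite -wE // fp ffunE mem_Knn_matching.
Qed.

Lemma expn2_le_extension_arcs (N : network) :
  st_path_extension (perfect_matching_polytope R (Knn n)) N ->
  (1 < n)%N -> (2 ^ n <= n.+1 * #|arcs N|)%N.
Proof.
move=> ext n1; rewrite (expnDn 1 1) big_ord_recl /= bin0.
under eq_bigr do rewrite !exp1n !muln1.
rewrite !exp1n !muln1 [leqRHS]mulSn; apply: leq_add.
  (* The bound excludes [k = 0]; that term equals 1, as does the one for [k = n]. *)
  have := bin_le_extension_arcs ext n1 (k := n); rewrite binn leqnn ltnW //.
  exact.
rewrite -[X in (_ <= X * _)%N]card_ord -sum_nat_const; apply: leq_sum => i _.
by rewrite /bump add1n; apply: (bin_le_extension_arcs ext n1); rewrite /= ltn_ord.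
Qed.

End Knn.

(** * Upper bound: the network of subsets *)

Section SubsetNetwork.
Variable n : nat.

Definition subset_arc : finType :=
  {a : {set 'I_n} * 'I_n | a.2 \notin a.1}.
Definition subset_tail (a : subset_arc) : {set 'I_n} := (val a).1.
Definition subset_col (a : subset_arc) : 'I_n := (val a).2.
Definition subset_head (a : subset_arc) := (subset_col a |: subset_tail a)%SET.

Notation walk := (diwalk subset_tail subset_head).

Lemma card_subset_arc : (#|subset_arc| <= 2 ^ n * n)%N.
Proof.
have <- : #|{: {set 'I_n} * 'I_n}| = (2 ^ n * n)%N.
  by rewrite card_prod card_ord -cardsT -powersetT card_powerset cardsT card_ord.
by rewrite card_sig max_card.
Qed.

Lemma card_subset_head a : #|subset_head a| = #|subset_tail a|.+1.
Proof. by rewrite /subset_head cardsU1 (valP a). Qed.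

Lemma subset_walk_card S p T : walk S p T -> #|T| = (#|S| + size p)%N.
Proof.
elim: p S => [|a p IH] S /=; first by move/eqP->; rewrite addn0.
by case/andP=> /eqP <- /IH ->; rewrite card_subset_head addSnnS.
Qed.

(** The cardinality of the node grows by one along each arc. *)
Fact subset_acyclic : acyclic subset_tail subset_head.
Proof.
by move=> S [//|a p] /subset_walk_card /eqP; rewrite -{1}[#|S|]addn0 eqn_add2l.
Qed.

Hypothesis n_gt0 : (0 < n)%N.

Fact subset_sink_neq_source : [set: 'I_n]%SET != finset.set0.
Proof. by rewrite -card_gt0 cardsT card_ord. Qed.

Definition subset_network : network :=
  Network subset_sink_neq_source subset_acyclic.

Fact subset_rank_subproof a : (#|subset_tail a| < n)%N.
Proof.
by rewrite -card_subset_head -[X in (_ <= X)%N]card_ord max_card.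
Qed.

Definition subset_rank a := Ordinal (subset_rank_subproof a).

Definition subset_edge a : edge (Knn n) :=
  Knn_edge (subset_rank a, subset_col a).

Lemma subset_walk_rank S p T :
  walk S p T -> [seq val (subset_rank a) | a <- p] = iota #|S| (size p).
Proof.
elim: p S => [//|a p IH] S /= /andP[/eqP <- /IH ->].
by rewrite card_subset_head.
Qed.

(** A column once inserted stays in all later subsets; the second conjunct carries this through the
    induction. *)
Lemma subset_walk_col S p T :
  walk S p T -> uniq (map subset_col p) && all (fun a => subset_col a \notin S) p.
Proof.
elim: p S => [//|a p IH] S /= /andP[/eqP <- /IH /andP[-> pS]].
rewrite (valP a) andbT /=; apply/andP; split.
  apply/negP => /mapP[b /(allP pS)].
  by rewrite /subset_head !inE negb_or => /andP[/negP + _] /eqP; rewrite eq_sym.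
apply: sub_all pS => b; rewrite /subset_head !inE negb_or.
by case/andP.
Qed.

(** The ranks along the path are 0, ..., n - 1 and its columns are distinct, so the column of the
    [i]-th arc defines [m i]. *)
Lemma subset_path_edges p : walk finset.set0 p [set: 'I_n]%SET ->
  exists m : 'S_n, map subset_edge p = [seq Knn_edge (i, m i) | i <- enum 'I_n].
Proof.
move=> wp; have := subset_walk_card wp.
rewrite cards0 cardsT card_ord add0n => sp.
have := subset_walk_rank wp; rewrite cards0 -sp => rp.
have /andP[up _] := subset_walk_col wp.
(* An arc to serve as the default of [nth]. *)
have [a0 _] : exists a0, a0 \in p.
  by move: n_gt0; rewrite sp; case: (p) => // a ? _; exists a; rewrite inE eqxx.
pose f (i : 'I_n) := subset_col (nth a0 p i).
have finj : injective f.
  move=> i j /eqP; rewrite /f -!(nth_map a0 (f i)) -?sp //.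
  by rewrite nth_uniq ?size_map -?sp // => /eqP /val_inj.
exists (perm finj); apply: (@eq_from_nth _ (subset_edge a0)).
  by rewrite !size_map -enumT size_enum_ord.
move=> k; rewrite size_map -sp => kn.
rewrite (nth_map a0) -?sp // (nth_map (Ordinal kn)) ?size_enum_ord //.
have -> : nth (Ordinal kn) (enum 'I_n) k = Ordinal kn.
  by apply/val_inj; rewrite /= nth_enum_ord.
rewrite permE /subset_edge; congr (Knn_edge (_, _)); apply/val_inj.
by rewrite -(nth_map a0 0%N (fun a => val (subset_rank a))) -?sp // rp nth_iota.
Qed.

Section PathOfPerm.
Variable m : 'S_n.

Let prefix k : {set 'I_n} := [set m i | i : 'I_n & (i < k)%N]%SET.

Let prefixP (i : 'I_n) : m i \notin prefix i.
Proof. by rewrite mem_imset ?inE ?ltnn //; exact: perm_inj. Qed.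

Let arc (i : 'I_n) : subset_arc :=
  exist (fun a : {set 'I_n} * 'I_n => a.2 \notin a.1) (prefix i, m i) (prefixP i).

Let prefixS (i : 'I_n) : subset_head (arc i) = prefix i.+1.
Proof.
apply/setP => j; rewrite -[j](permKV m) !inE (inj_eq perm_inj).
rewrite !mem_imset; try exact: perm_inj.
by rewrite !inE ltnS [RHS]leq_eqVlt.
Qed.

(** Induction on the number [k] of arcs still to traverse, backwards from the full set. *)
Let walk_drop k : (k <= n)%N ->
  walk (prefix (n - k)) (map arc (drop (n - k) (enum 'I_n))) [set: 'I_n]%SET.
Proof.
elim: k => [_|k IH kn].
  rewrite subn0 drop_oversize ?size_enum_ord //=; apply/eqP/setP => j.
  rewrite -[j](permKV m) mem_imset ?inE ?ltn_ord //; exact: perm_inj.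
have lt : (n - k.+1 < n)%N by rewrite ltn_subrL.
rewrite (drop_nth (Ordinal lt)) ?size_enum_ord //=.
have -> : nth (Ordinal lt) (enum 'I_n) (n - k.+1) = Ordinal lt.
  by apply/val_inj; rewrite /= nth_enum_ord.
by rewrite eqxx prefixS /= -subSn // subSS IH // ltnW.
Qed.

Lemma perm_subset_path : exists2 p, walk finset.set0 p [set: 'I_n]%SET &
  map subset_edge p = [seq Knn_edge (i, m i) | i <- enum 'I_n].
Proof.
have wp : walk finset.set0 (map arc (enum 'I_n)) [set: 'I_n]%SET.
  have := walk_drop (leqnn n); rewrite subnn drop0.
  suff -> : prefix 0 = finset.set0 by [].
  by apply/setP => j; rewrite -[j](permKV m) mem_imset ?inE //; exact: perm_inj.
exists (map arc (enum 'I_n)) => //.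
(* The ranks are read off the walk, which avoids computing the cardinalities of the prefixes. *)
have := subset_walk_rank wp.
rewrite cards0 size_map size_enum_ord -val_enum_ord -map_comp => /eq_in_map rank_arc.
rewrite -map_comp; apply: eq_map => i; congr (Knn_edge (_, _)); apply/val_inj.
by apply: rank_arc; rewrite mem_enum.
Qed.

End PathOfPerm.

(** By [image_conv_hull] it is enough to compare generators: paths and permutations give the same
    matchings. *)
Lemma subset_network_extension (R : realType) :
  st_path_extension (perfect_matching_polytope R (Knn n)) subset_network.
Proof.
exists (fiber_sum subset_edge); rewrite image_conv_hull; congr (conv_hull _).
have pathE p : st_path (N := subset_network) p <->
    walk finset.set0 p [set: 'I_n]%SET.
  by rewrite /st_path dipathE //; exact: subset_acyclic.
have edgesE (p : seq subset_arc) (m : 'S_n) :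
    map subset_edge p = [seq Knn_edge (i, m i) | i <- enum 'I_n] ->
    fiber_sum subset_edge (incidence R [set a in p]%SET) =
    incidence R (Knn_matching m).
  move=> pm; rewrite fiber_sum_incidence; last first.
    by rewrite pm map_inj_uniq ?enum_uniq // => i j /Knn_edge_inj [].
  congr (incidence R _); apply/setP => e; rewrite inE pm.
  have [ij ->] := Knn_edge_surj e; rewrite mem_Knn_matching.
  apply/mapP/eqP => [[i _ /Knn_edge_inj -> //]|E].
  by exists ij.1; rewrite ?mem_enum // E -surjective_pairing.
apply/seteqP; split.
  move=> _ [_ [p /pathE wp <-] <-]; have [m pm] := subset_path_edges wp.
  exists (Knn_matching m); first exact: perfect_Knn_matching.
  exact: (esym (edgesE _ _ pm)).
move=> _ [M /perfect_matching_Knn[m ->] <-].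
have [p /pathE sp pm] := perm_subset_path m.
by exists (incidence R [set a in p]%SET); [exists p|exact: edgesE].
Qed.

End SubsetNetwork.

(** * The extension complexity *)

(** One extension rules out the default value 0, so the minimum is attained. *)
Lemma st_path_xcP (R : realType) (I : finType) (P : set (rvec R I)) k :
  has_st_path_extension P k ->
  has_st_path_extension P (st_path_xc P) /\ (st_path_xc P <= k)%N.
Proof.
move=> Pk; rewrite /st_path_xc; case: pselect => [exk|[]]; last first.
  by exists k; apply/asboolP.
case: ex_minnP => j /asboolP Pj jmin; split=> //.
by apply: jmin; apply/asboolP.
Qed.

Theorem mainTheorem5 (R : realType) :
  Theta_star
    (fun n : nat => (st_path_xc (perfect_matching_polytope R (Knn n)))%:R : R)
    (fun n : nat => 2 ^+ n : R).
Proof.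
have pE (n : nat) : ('X + 1 : {poly R}).[n%:R] = n.+1%:R by rewrite !hornerE -natr1.
(* The factor [n + 1] counts the binomial coefficients in the lower bound and dominates the [n] of
   the arc count [2 ^ n * n]. *)
exists ('X + 1); first by move=> n _; rewrite pE.
(* The lower bound requires [1 < n], through [r_t]. *)
exists 2%N => // n /= n1; rewrite pE.
have n0 : (0 < n)%N by exact: ltnW.
have [[N ext eN] le_xc] :=
  st_path_xcP (ex_intro2 _ _ _ (subset_network_extension n0 R) erefl).
rewrite -natrX -natrM ler_pdivrMr ?ltr0n // -natrM !ler_nat mulnC -eN.
rewrite (expn2_le_extension_arcs ext n1) eN /=.
apply: leq_trans le_xc (leq_trans (card_subset_arc n) _).
by rewrite mulnC leq_mul2r leqnSn orbT.
Qed.
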